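(* For any prime $p\equiv 1\pmod 4$, $$\left(\frac{\sqrt{S_{1+\frac{p-1}{2},2}(-1,p)}}{p}\right)=(-1)^{\left|\left\{0<r<\frac{p}{4}\,:\,\left(\frac{r}{p}\right)=-1\right\}\right|}\left(\frac{p}{3}\right),$$ where $r$ ranges over integers.
   Context: For an odd prime $p$, let $\alpha_1,\ldots,\alpha_{(p-1)/2}$ be integers representing the distinct (nonzero) quadratic residues modulo $p$, and for $n\in\mathbb{N}$, $d\in\mathbb{Z}$ put $$S_{n,2}(d,p)=\det\left[(\alpha_i+d\,\alpha_j)^n\right]_{1\le i,j\le \frac{p-1}{2}}.$$ When $p\equiv 1\pmod 4$ and $n$ is odd, $S_{n,2}(-1,p)$ is the determinant of a skew-symmetric integer matrix of even order, hence the square of an integer, and $\sqrt{S_{n,2}(-1,p)}$ denotes its integer square root (the sign is immaterial inside the Legendre symbol since $p\equiv 1\pmod 4$). $\left(\frac{\cdot}{p}\right)$ and $\left(\frac{\cdot}{3}\right)$ are Legendre symbols. *)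

(* Defs.v *)
(* MathComp *)
From mathcomp Require Import all_boot all_order all_algebra.
Set Implicit Arguments.
Unset Strict Implicit.
Unset Printing Implicit Defensive.
Import GRing.Theory.
Local Open Scope ring_scope.

(* Legendre symbol (a / p); meaningful for p an odd prime. *)
Definition legendre (a : int) (p : nat) : int :=
  if (p%:Z %| a)%Z then 0
  else if [exists x : 'I_p, (x%:Z ^+ 2 == a %[mod p%:Z])%Z] then 1
  else -1.

(* alpha lists representatives, one for each class of nonzero quadratic
   residues modulo p; the representatives are arbitrary integers. *)
Definition represents_residues (p : nat) (alpha : 'I_((p - 1) %/ 2) -> int) :=
  [/\ forall i, legendre (alpha i) p = 1,
      forall i j, (alpha i = alpha j %[mod p%:Z])%Z -> i = j
    & forall a : int, legendre a p = 1 ->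
        exists i, (alpha i = a %[mod p%:Z])%Z].

Definition S2 (n : nat) (d : int) (p : nat)
    (alpha : 'I_((p - 1) %/ 2) -> int) : int :=
  \det (\matrix_(i, j) (alpha i + d * alpha j) ^+ n).

(* Main.v *)
Require Import Defs.
From mathcomp Require Import all_boot all_order all_algebra cyclic finfield.
From mathcomp Require Import ring zify.
Set Implicit Arguments.
Unset Strict Implicit.
Unset Printing Implicit Defensive.
Import GRing.Theory.
Local Open Scope ring_scope.

(** Write p = 4h+1 and m = 2h. Modulo p the alpha_i are the m-th roots of unity
    and the reduced binomial expansion of (alpha_i - alpha_j)^(m+1) factors the
    matrix, giving S = - m^m prod_k c_k with c_0 = m+2 = - c_1 and
    c_k = (-1)^k C(m+1,k) for 1 < k < m. By Euler's criterion the Legendre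
    symbol of s is s^m = S^h, so only the quadratic characters E(x) = x^m of
    m, m+2 and of factorials matter. As m = -1/2, m+1 = 1/2 and m+2 = 3/2 in
    F_p, and as i = m! has i^2 = -1, whence E(m!) = E(2), everything reduces to
    the character of prod_(k < 2h) k!. Pairing (2i)! with (2i+1)! shows that this
    product is a square times (2h)! / (2^h h!), and one is left with
    E(3) E(h!), where E(3) = (p/3) through cube roots of unity.
    That S is a square in Z holds for every skew-symmetric integer matrix, by
    eliminating 2x2 skew blocks over the rationals. *)

(** * Skew-symmetric determinants as squares *)

Lemma det_block_schur (F : fieldType) m n (A : 'M[F]_m) B C (D : 'M[F]_n) :
  A \in unitmx ->
  \det (block_mx A B C D) = \det A * \det (D - C *m invmx A *m B).
Proof.
move=> uA; have ->: block_mx A B C D =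
    block_mx 1%:M 0 (C *m invmx A) 1%:M *m
    block_mx A B 0 (D - C *m invmx A *m B).
  rewrite mulmx_block !mul1mx !mul0mx !addr0 mulmxKV //.
  by rewrite addrC subrK.
by rewrite det_mulmx det_lblock !det1 !mul1r det_ublock.
Qed.

Lemma det_conj_perm (R : comPzRingType) n (s : perm.perm_of 'I_n) (A : 'M[R]_n) :
  \det (row_perm s (col_perm s A)) = \det A.
Proof.
rewrite row_permE col_permE !det_mulmx !det_perm perm.odd_permV mulrCA.
by rewrite -signr_addb addbb mulr1.
Qed.

Lemma det_mx22 (R : comPzRingType) (A : 'M[R]_2) :
  \det A = A 0 0 * A 1 1 - A 0 1 * A 1 0.
Proof.
rewrite (expand_det_row _ 0) !big_ord_recl big_ord0 addr0 /cofactor !det_mx11.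
rewrite !mxE /= expr0 expr1 mul1r mulN1r mulrN.
by congr (A _ _ * A _ _ - A _ _ * A _ _); apply/val_inj.
Qed.

(** Strong induction on the order. A simultaneous row and column swap brings a nonzero entry of the
    first row to position (0, 1). The leading 2x2 block is then invertible with square determinant,
    and its Schur complement is again skew-symmetric. *)
Lemma det_skew_square (F : fieldType) n (A : 'M[F]_n) :
  2%:R != 0 :> F -> A^T = - A -> exists s, \det A = s ^+ 2.
Proof.
move=> F2; elim/ltn_ind: n A => -[|[|n]] IHn A skA.
- by exists 1; rewrite det_mx00 expr1n.
- have A00 : A 0 0 = 0.
    have /matrixP/(_ 0 0) := skA; rewrite !mxE => /eqP.
    by rewrite -addr_eq0 -mulr2n -mulr_natr mulf_eq0 (negPf F2) orbF => /eqP.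
  by exists 0; rewrite {1}[A]mx11_scalar det_scalar1 A00 expr0n.
have skE i j : A i j = - A j i.
  by have /matrixP/(_ j i) := skA; rewrite !mxE.
have A0 i : A i i = 0.
  apply/eqP; have /eqP := skE i i.
  by rewrite -addr_eq0 -mulr2n -mulr_natr mulf_eq0 (negPf F2) orbF.
have [/existsP[j Aj] | /existsPn rowA0] := boolP [exists j, A ord0 j != 0]; last first.
  exists 0; rewrite (expand_det_row _ ord0) big1 ?expr0n // => j _.
  by have /negPn/eqP-> := rowA0 j; rewrite mul0r.
pose o1 : 'I_n.+2 := inord 1.
have o1E : o1 = 1 :> nat by rewrite inordK.
have j0 : ord0 != j by apply: contraNneq Aj => <-; rewrite A0.
pose s : perm.perm_of 'I_n.+2 := perm.tperm o1 j.
pose A' : 'M[F]_(2 + n) := row_perm s (col_perm s A).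
have dA' : \det A = \det A' by rewrite det_conj_perm.
have skA' : A'^T = - A' by apply/matrixP=> x y; rewrite !mxE skE.
have a01 : A' ord0 o1 != 0.
  rewrite !mxE perm.tpermL perm.tpermD // 1?eq_sym //.
  by rewrite -val_eqE /= o1E.
have skA'E i k : A' i k = - A' k i by rewrite !mxE skE.
have A'0 i : A' i i = 0 by rewrite !mxE A0.
suff [t dt] : exists t, \det A' = t ^+ 2 by exists t; rewrite dA'.
(* From here only the skewness of [A'] and [a01] matter, not how [A'] was permuted. *)
clear dA'; clearbody A'.
pose J : 'M_2 := ulsubmx A'; pose B := ursubmx A'; pose D := drsubmx A'.
have skJ : J^T = - J by rewrite /J trmx_ulsub skA'; apply/matrixP=> x y; rewrite !mxE.
have skD : D^T = - D by rewrite /D trmx_drsub skA'; apply/matrixP=> x y; rewrite !mxE.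
have CB : dlsubmx A' = - B^T.
  by rewrite /B trmx_ursub skA'; apply/matrixP=> x y; rewrite !mxE opprK.
have detJ : \det J = (A' ord0 o1) ^+ 2.
  rewrite det_mx22 !mxE.
  have -> : lshift n (0 : 'I_2) = ord0 by apply/val_inj.
  have -> : lshift n (1 : 'I_2) = o1 by apply/ord_inj; rewrite o1E.
  by rewrite !A'0 mul0r sub0r (skA'E o1) mulrN opprK.
have uJ : J \in unitmx by rewrite unitmxE detJ unitfE expf_neq0.
rewrite -[A']submxK det_block_schur // detJ CB.
(* The inverse of a skew matrix is skew, hence so is the Schur complement. *)
have [|t ->] := IHn n (leqnSn n.+1) (D - - B^T *m invmx J *m B).
  rewrite [LHS]linearB /= skD !trmx_mul linearN /= trmxK trmx_inv skJ.
  have -> : invmx (- J) = - invmx J.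
    have uN : - J \in unitmx by rewrite -skJ unitmx_tr.
    by rewrite -[LHS]mulmx1 -(mulmxV uJ) -[J in _ *m (J *m _)]opprK mulNmx mulmxN mulKmx.
  by rewrite !mulNmx !mulmxN !mulmxA !opprK opprD.
by exists (A' ord0 o1 * t); rewrite exprMn.
Qed.

(** The squared denominator of [q] divides the squared numerator; being coprime to the numerator,
    the denominator is 1. *)
Lemma rat_sqr_int (S : int) (q : rat) :
  S%:~R = q ^+ 2 -> exists s : int, 0 <= s /\ s ^+ 2 = S.
Proof.
move=> Sq; exists `|numq q|; split; first exact: Num.Theory.normr_ge0.
have nd : numq q ^+ 2 = S * denq q ^+ 2.
  by apply: (@intr_inj rat); rewrite rmorphXn /= numqE exprMn -Sq rmorphM rmorphXn.
have d1 : denq q = 1.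
  have : (denq q %| numq q)%Z.
    by rewrite -(dvdz_pexp2r _ _ (isT : 0 < 2)%N) nd dvdz_mull.
  rewrite dvdzE => /gcdn_idPr; have := coprime_num_den q.
  rewrite /coprime => /eqP -> absd.
  by rewrite -absz_denq -absd.
by rewrite Num.Theory.real_normK ?Num.Theory.num_real // nd d1 expr1n mulr1.
Qed.

Lemma det_skew_int n (A : 'M[int]_n) :
  A^T = - A -> exists s : int, 0 <= s /\ s ^+ 2 = \det A.
Proof.
move=> skA; have [||q detq] := @det_skew_square rat n (map_mx intr A).
- by [].
- by rewrite map_trmx skA map_mxN.
by apply: (@rat_sqr_int _ q); rewrite -detq det_map_mx.
Qed.

(** * Euler's criterion and the passage to ['F_p] *)

Lemma expf_card_pred (F : finFieldType) (x : F) : x != 0 -> x ^+ #|F|.-1 = 1.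
Proof.
move=> x0; apply: (mulfI x0); rewrite mulr1 -exprS prednK ?expf_card //.
exact: ltnW (card_finNzRing_gt1 F).
Qed.

Lemma finField_prim_root (F : finFieldType) :
  exists z : F, #|F|.-1.-primitive_root z.
Proof.
pose rs := enum (predC1 (0 : F)).
have /hasP[z _ ?] : has #|F|.-1.-primitive_root rs; last by exists z.
apply: has_prim_root.
- by rewrite -subn1 subn_gt0 card_finNzRing_gt1.
- apply/allP=> x; rewrite mem_enum => x0.
  by rewrite unity_rootE expf_card_pred.
- exact: enum_uniq.
- by rewrite -cardE cardC1.
Qed.

(** Write x = z^i for a generator z: x^m = 1 means that 2m divides i m, that is, i is even. *)
Lemma expf_half_sqr (F : finFieldType) m (x : F) :
  #|F| = m.*2.+1 -> x != 0 -> (x ^+ m == 1) = [exists y : F, y ^+ 2 == x].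
Proof.
move=> cF x0; have [z] := finField_prim_root F; rewrite cF /= => pz.
have xx (y : F) : y != 0 -> y ^+ m.*2 = 1.
  by move=> /expf_card_pred; rewrite cF.
apply/eqP/existsP => [xm | [y /eqP xy]]; last first.
  rewrite -xy -exprM mul2n xx //; apply: contraNneq x0 => y0.
  by rewrite -xy y0 expr0n.
have [[i /= _] xi] := prim_rootP pz (xx x x0).
move: xm; rewrite xi -exprM => /eqP; rewrite -(prim_order_dvd pz) => dv.
have m0 : (0 < m)%N by have := prim_order_gt0 pz; rewrite double_gt0.
move: dv; rewrite -mul2n dvdn_pmul2r // => /dvdnP[k ik].
by exists (z ^+ k); rewrite -exprM ik.
Qed.

Lemma intr_Fp (p : nat) (y : 'F_p) : prime p -> exists x : 'I_p, y = x%:Z%:~R.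
Proof.
move=> pp; have yp : (y < p)%N by rewrite -[X in (_ < X)%N](Fp_cast pp) ltn_ord.
by exists (Ordinal yp); rewrite /= -pmulrn natr_Zp.
Qed.

Lemma intr_Fp_eq0 (p : nat) (a : int) :
  prime p -> (a%:~R == 0 :> 'F_p) = (p%:Z %| a)%Z.
Proof. by move=> pp; rewrite (dvdz_pcharf (pchar_Fp pp)). Qed.

Lemma intr_Fp_eq (p : nat) (a b : int) :
  prime p -> (a%:~R == b%:~R :> 'F_p) = (a == b %[mod p%:Z])%Z.
Proof.
by move=> pp; rewrite eqz_mod_dvd -intr_Fp_eq0 // rmorphB /= subr_eq0.
Qed.

Lemma euler_legendre (p : nat) (a : int) :
  prime p -> odd p -> (legendre a p)%:~R = a%:~R ^+ ((p - 1) %/ 2) :> 'F_p.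
Proof.
move=> pp op; have [m pm] : exists m, p = m.*2.+1.
  by exists p./2; rewrite -[LHS]odd_double_half op.
have -> : ((p - 1) %/ 2 = m)%N by rewrite pm subn1 divn2 doubleK.
have m0 : (0 < m)%N by have := prime_gt1 pp; rewrite pm; case: (m).
have cF : #|'F_p| = m.*2.+1 by rewrite card_Fp.
rewrite /legendre -intr_Fp_eq0 //; have [-> | a0] := eqVneq.
  by rewrite expr0n gtn_eqF.
have -> : [exists x : 'I_p, (x%:Z ^+ 2 == a %[mod p%:Z])%Z] =
          [exists y : 'F_p, y ^+ 2 == a%:~R].
  apply/existsP/existsP => [[x] | [y]].
    by rewrite -intr_Fp_eq // rmorphXn; exists x%:Z%:~R.
  by have [x ->] := intr_Fp y pp; rewrite -rmorphXn intr_Fp_eq //; exists x.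
rewrite -(expf_half_sqr cF a0); have [-> // | am1] := eqVneq.
have : (a%:~R ^+ m) ^+ 2 = 1 :> 'F_p.
  by rewrite -exprM muln2; have := expf_card_pred a0; rewrite cF.
by move/eqP; rewrite sqrf_eq1 (negPf am1) => /eqP->.
Qed.

(** Two of the values 0, 1, -1 differ by at most 2 < p. This lets identities between signs be
    verified in ['F_p]. *)
Lemma intr_Fp_sign_inj (p : nat) (a b : int) : prime p -> odd p ->
  (a \in [:: 0; 1; -1]) -> (b \in [:: 0; 1; -1]) ->
  a%:~R = b%:~R :> 'F_p -> a = b.
Proof.
move=> pp op ain bin /eqP; rewrite intr_Fp_eq // eqz_mod_dvd => dv.
have p2 : (2 < p)%N by apply: odd_prime_gt2.
apply/eqP; rewrite -subr_eq0; apply: contraLR dv => ab.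
rewrite dvdzE gtnNdvd ?absz_gt0 //; apply: leq_ltn_trans p2.
by move: ain bin; rewrite !inE => /or3P[]/eqP-> /or3P[]/eqP->.
Qed.

Lemma legendre_mem (a : int) p : legendre a p \in [:: 0; 1; -1].
Proof. by rewrite /legendre; case: ifP => // _; case: ifP. Qed.


(** * Products of factorials and binomials *)

Lemma prod_fact_double h :
  ((\prod_(k < h.*2) k`!) * (2 ^ h * h`!) =
   (\prod_(k < h) (k.*2)`!) ^ 2 * (h.*2)`!)%N.
Proof.
elim: h => [|h IHh]; first by rewrite !big_ord0.
rewrite doubleS !big_ord_recr /= expnS !factS; move: IHh.
set P := (\prod_(_ < _) _)%N; set Q := (\prod_(_ < _) _)%N => IHh.
transitivity (P * (2 ^ h * h`!) *
  (h.*2`! * (h.*2.+1 * h.*2`!) * (2 * h.+1)))%N; first by ring.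
by rewrite IHh -muln2; ring.
Qed.

(** Reversing the order of the factors turns one copy of the factorial product into that of the
    (n-k)!, and each C(n+1,k+1) (k+1)! (n-k)! is (n+1)!. *)
Lemma prod_bin_fact n :
  ((\prod_(k < n) 'C(n.+1, k.+1)) * (\prod_(k < n) k.+1`!) ^ 2 =
  n.+1`! ^ n)%N.
Proof.
have rv : (\prod_(k < n) k.+1`! = \prod_(k < n) (n.+1 - k.+1)`!)%N.
  rewrite (reindex_inj rev_ord_inj) /=; apply: eq_bigr => k _.
  by rewrite subSS subnSK.
rewrite expnS expn1 {2}rv -!big_split /= (eq_bigr (fun=> n.+1`!)).
  by rewrite prod_nat_const card_ord.
by move=> k _; rewrite bin_fact // ltnW // ltnS.
Qed.

(** * The determinant over roots of unity *)

Lemma prim_root_sum_expr (F : fieldType) n (z : F) e :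
  n.-primitive_root z -> ~~ (n %| e)%N -> \sum_(i < n) (z ^+ i) ^+ e = 0.
Proof.
move=> pz ne; have z1 : z ^+ e - 1 != 0.
  by rewrite subr_eq0 -(prim_order_dvd pz).
apply: (mulfI z1); rewrite mulr0.
have -> : \sum_(i < n) (z ^+ i) ^+ e = \sum_(i < n) (z ^+ e) ^+ i.
  by apply: eq_bigr => i _; rewrite exprAC.
by rewrite -subrX1 exprAC (prim_expr_order pz) expr1n subrr.
Qed.

(** The exponents add up to h (2h-1), an odd multiple of h, and z^h = -1 as a square root of 1 other
    than 1. *)
Lemma prim_root_prod (F : fieldType) h (z : F) :
  (0 < h)%N -> h.*2.-primitive_root z -> \prod_(i < h.*2) z ^+ i = -1.
Proof.
move=> h0 pz; rewrite prodrXr -(big_mkord predT id) bin2_sum bin2.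
have -> : ((h.*2 * h.*2.-1)./2 = h * h.*2.-1)%N by rewrite -doubleMl doubleK.
have zh : z ^+ h = -1.
  have : (z ^+ h) ^+ 2 = 1 by rewrite -exprM muln2 (prim_expr_order pz).
  move/eqP; rewrite sqrf_eq1 -(prim_order_dvd pz) => /orP[|/eqP//].
  by move/dvdn_leq => /(_ h0); rewrite -addnn -[X in (_ <= X)%N]addn0 leq_add2l leqNgt h0.
rewrite exprM zh -signr_odd.
by case: h h0 {pz zh} => // h _; rewrite doubleS /= odd_double.
Qed.

(* Folding k = m and k = m+1 of the binomial expansion of (x - y)^(m+1) onto
   k = 0 and k = 1 by means of x^m = y^m = 1 (m even), the coefficient of
   x^(m+1-k) y^k becomes: *)
Definition red_coef (R : pzRingType) m k : R :=
  (-1) ^+ k * 'C(m.+1, k)%:R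
  + (if k == 0%N then m.+1%:R else if k == 1%N then -1 else 0).

Lemma exprB_red (R : comPzRingType) m (x y : R) : (1 < m)%N -> ~~ odd m ->
  x ^+ m = 1 -> y ^+ m = 1 ->
  (x - y) ^+ m.+1 = \sum_(k < m) x * (x ^+ (m - k) * (red_coef R m k * y ^+ k)).
Proof.
move=> m1 em xm ym; have -> : (x - y) ^+ m.+1 =
    \sum_(i < m.+2) (-1) ^+ i * x ^+ (m.+1 - i) * y ^+ i *+ 'C(m.+1, i).
  exact: exprBn.
rewrite 2!big_ord_recr /=.
rewrite subnn binn subSnn binSn exprS -signr_odd (negPf em).
(* The corrections at k = 0 and k = 1 are the two top binomial terms: (m+1) x y^m = (m+1) x, and -
   y^(m+1) = - y. *)
rewrite [RHS](eq_bigr (fun k : 'I_m =>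
  (-1) ^+ k * x ^+ (m.+1 - k) * y ^+ k *+ 'C(m.+1, k) +
  (if val k == 0%N then m.+1%:R * x else if val k == 1%N then - y else 0))).
  rewrite big_split /= -!addrA; congr (_ + _).
  case: m m1 em xm ym => [|[|m]] // _ em xm ym.
  rewrite 2!big_ord_recl big1 /= ?addr0 //.
  rewrite (exprS y m.+2) ym -(signr_odd _ m.+3) oddS em.
  by rewrite !expr0 expr1 !mulr1 mul1r mulr_natl mulN1r.
move=> k _; have km : (k <= m)%N by apply: ltnW.
rewrite /red_coef subSn // exprS -mulr_natl.
case: k km => -[|[|k]] lk km /=; rewrite ?subn0 ?xm ?expr0 ?expr1; first by ring.
  have xx : x * x ^+ (m - 1) = 1 by rewrite -exprS subn1 prednK // ltnW.
  have -> : - y = - (x * x ^+ (m - 1)) * y by rewrite xx mulN1r.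
  rewrite bin1; ring.
ring.
Qed.

(* With V = (a_i^(m-k)) and U = (a_j^k), the matrix is diag(a) V diag(c) U for
   c = red_coef, where U V = m and the a_i multiply to -1. *)
Lemma det_exprB_roots (F : fieldType) h (z : F) (a : 'I_h.*2 -> F) :
  (0 < h)%N -> h.*2.-primitive_root z ->
  (forall i, a i ^+ h.*2 = 1) -> injective a ->
  \det (\matrix_(i, j) (a i - a j) ^+ h.*2.+1) =
  - (h.*2%:R ^+ h.*2 * \prod_(k < h.*2) red_coef F h.*2 k).
Proof.
set m := h.*2 => h0 pz am ainj.
have m1 : (1 < m)%N by rewrite /m; case: (h) h0.
pose f i := sval (prim_rootP pz (am i)).
have af i : a i = z ^+ f i by rewrite /f; case: prim_rootP.
have finj : injective f by move=> i j ij; apply: ainj; rewrite !af ij.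
pose V : 'M_m := \matrix_(i, k) a i ^+ (m - k).
pose U : 'M_m := \matrix_(k, j) a j ^+ k.
have -> : \matrix_(i, j) (a i - a j) ^+ m.+1 =
    diag_mx (\row_i a i) *m (V *m (diag_mx (\row_k red_coef F m k) *m U)).
  apply/matrixP=> i j; rewrite mul_diag_mx !mxE.
  rewrite (exprB_red m1 _ (am i) (am j)) ?odd_double // mulr_sumr.
  by apply: eq_bigr => k _; rewrite mul_diag_mx !mxE.
(* An injective [f] permutes the exponents, so the [a j] run over all powers of [z]. *)
have sf e : \sum_j (z ^+ f j) ^+ e = \sum_(i < m) (z ^+ i) ^+ e.
  by rewrite [RHS](reindex_inj finj).
have UV : U *m V = m%:R%:M.
  apply/matrixP=> k l; rewrite !mxE.
  rewrite (eq_bigr (fun j => (z ^+ f j) ^+ (k + (m - l)))); last first.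
    by move=> j _; rewrite !mxE -exprD af.
  rewrite sf.
  have [-> | kl] := eqVneq k l.
    rewrite mulr1n (eq_bigr (fun=> 1)) ?sumr_const ?card_ord // => i _.
    by rewrite subnKC 1?ltnW // exprAC (prim_expr_order pz) expr1n.
  (* Off the diagonal, m does not divide the exponent k + (m - l), as k and l are distinct and below
     m. *)
  rewrite mulr0n prim_root_sum_expr //; apply: contraNN kl => /dvdnP[q qE].
  have {}qE : (k + m = q * m + l)%N.
    by rewrite -qE -addnA subnK // ltnW.
  have : (k + m = l %[mod m])%N by rewrite qE modnMDl.
  by rewrite modnDr !modn_small // => /val_inj ->.
have pa : \prod_i a i = -1.
  rewrite -(prim_root_prod h0 pz) [RHS](reindex_inj finj).
  by apply: eq_bigr => i _; rewrite af.
have dUV : \det U * \det V = m%:R ^+ m by rewrite -det_mulmx UV det_scalar.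
rewrite !det_mulmx !det_diag.
rewrite (eq_bigr a) => [|i _]; last by rewrite mxE.
rewrite pa (eq_bigr (fun k : 'I_m => red_coef F m k)) => [|i _]; last by rewrite mxE.
by rewrite -dUV; ring.
Qed.

(** With m = 2(n+1), the first two coefficients are m+2 and -(m+2); the signs of the others multiply
    to (-1)^n. *)
Lemma prod_red_coef (R : comPzRingType) n :
  \prod_(k < n.+1.*2) red_coef R n.+1.*2 k =
  (-1) ^+ n.+1 * n.+2.*2%:R ^+ 2 * (\prod_(k < n.*2) 'C(n.+1.*2.+1, k.+2))%:R.
Proof.
rewrite doubleS 2!big_ord_recl /= {1 2}/red_coef /= bin0 bin1 expr0 expr1.
rewrite (eq_bigr (fun k : 'I_n.*2 => (-1) ^+ k * 'C(n.*2.+3, k.+2)%:R)); last first.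
  by move=> k _; rewrite /red_coef /bump /= addr0 -signr_odd /= negbK signr_odd.
rewrite big_split /= -natr_prod.
have -> : \prod_(k < n.*2) (-1) ^+ k = (-1) ^+ n :> R.
  elim: n => [|n IHn]; first by rewrite big_ord0.
  rewrite doubleS !big_ord_recr /= IHn -mulrA -exprD addnS exprS addnn.
  by rewrite -(signr_odd _ n.*2.*2) odd_double mulr1 exprSr.
set P := _%:R; set s := (-1) ^+ n; rewrite exprS -/s.
have -> : n.+2.*2%:R = 1 + n.*2.+3%:R :> R by rewrite -(natrD _ 1).
ring.
Qed.

(** For m = n+2, this is [prod_bin_fact] with the end binomials C(m+1,1) = C(m+1,m) = m+1 split
    off. *)
Lemma prod_bin_fact_inner n :
  ((\prod_(k < n) 'C(n.+3, k.+2)) * (n.+3 * \prod_(k < n.+2) k`! * n.+2`!) ^ 2 =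
  n.+3`! ^ n.+2)%N.
Proof.
have bE : (\prod_(k < n.+2) 'C(n.+3, k.+1) =
    n.+3 ^ 2 * \prod_(k < n) 'C(n.+3, k.+2))%N.
  rewrite big_ord_recl big_ord_recr /= bin1 binSn expnS expn1 -mulnA.
  by congr (_ * _)%N; rewrite mulnC.
have fE : (\prod_(k < n.+2) k.+1`! = \prod_(k < n.+2) k`! * n.+2`!)%N.
  transitivity (\prod_(k < n.+3) k`!)%N; last by rewrite big_ord_recr.
  by rewrite [RHS]big_ord_recl mul1n.
by rewrite -prod_bin_fact bE fE -(mulnA n.+3) expnMn mulnA (mulnC _ (n.+3 ^ 2)%N).
Qed.

(** * Quadratic characters of m!, 2 and 3 *)

Lemma natr_Fp_eq0 (p n : nat) : prime p -> (n%:R == 0 :> 'F_p) = (p %| n)%N.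
Proof. by move=> pp; rewrite (dvdn_pcharf (pchar_Fp pp)). Qed.

Lemma fact_Fp_neq0 (p n : nat) : prime p -> (n < p)%N -> n`!%:R != 0 :> 'F_p.
Proof.
move=> pp; elim: n => [|n IHn] np; first by rewrite oner_neq0.
rewrite factS natrM mulf_neq0 ?IHn 1?ltnW // natr_Fp_eq0 //.
by rewrite gtnNdvd.
Qed.

(** Wilson's theorem: in (2m)! the upper m factors 2m - j equal -(j+1) modulo p, giving (-1)^m
    m!. *)
Lemma fact_half_sqr (p m : nat) : prime p -> p = m.*2.+1 ->
  (-1) ^+ m * m`!%:R ^+ 2 = -1 :> 'F_p.
Proof.
move=> pp pm; have p0 : m.*2.+1%:R = 0 :> 'F_p.
  by apply/eqP; rewrite natr_Fp_eq0 // -pm.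
have fE j : (j <= m.*2)%N -> (m.*2 ^_ j)%:R = (-1) ^+ j * j`!%:R :> 'F_p.
  elim: j => [|j IHj] jm; first by rewrite mulr1.
  have dE : (m.*2 - j)%:R = - j.+1%:R :> 'F_p.
    apply/eqP; rewrite -addr_eq0 -natrD -subSS subnK ?p0 //.
    exact: leqW.
  by rewrite ffactnSr natrM IHj ?(ltnW jm) // dE factS natrM exprS; ring.
have mm : (m <= m.*2)%N by rewrite -addnn leq_addr.
have : (m.*2)`!%:R = -1 :> 'F_p.
  apply/eqP; rewrite -addr_eq0 natr1 natr_Fp_eq0 //.
  by have := Wilson (prime_gt1 pp); rewrite pp {2}pm /= => <-.
rewrite -(ffact_fact mm) natrM fE //.
have -> : (m.*2 - m = m)%N by rewrite -addnn addnK.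
by move=> E; rewrite -[RHS]E -mulrA expr2.
Qed.

Lemma half_order_sqr1 (p m : nat) (x : 'F_p) : prime p -> p = m.*2.+1 ->
  x != 0 -> (x ^+ m) ^+ 2 = 1.
Proof.
move=> pp pm x0; rewrite -exprM muln2.
have cF : #|'F_p| = m.*2.+1 by rewrite card_Fp.
by have := expf_card_pred x0; rewrite cF.
Qed.

(* i = m! satisfies i^2 = -1, so that 2 i = (1 + i)^2 is a square *)
Lemma fact_half_euler (p h : nat) : prime p -> p = h.*2.*2.+1 ->
  (h.*2)`!%:R ^+ h.*2 = 2%:R ^+ h.*2 :> 'F_p.
Proof.
set m := h.*2 => pp pm; set i : 'F_p := m`!%:R.
have i2 : i ^+ 2 = -1.
  by rewrite -(fact_half_sqr pp pm) -signr_odd odd_double mul1r.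
have mp : (m < p)%N by rewrite pm ltnS -addnn leq_addr.
have p2 : (2 < p)%N.
  by have := prime_gt1 pp; rewrite pm /m; case: (h).
have i0 : i != 0 by apply: fact_Fp_neq0.
have two0 : 2%:R != 0 :> 'F_p by rewrite natr_Fp_eq0 // gtnNdvd.
have e : 2%:R * i = (1 + i) ^+ 2 by rewrite sqrrD expr1n i2; ring.
have i10 : 1 + i != 0.
  by apply: contraNneq (mulf_neq0 two0 i0) => i1; rewrite e i1 expr0n.
have : 2%:R ^+ m * i ^+ m = 1.
  by rewrite -exprMn e exprAC (half_order_sqr1 pp pm).
have := half_order_sqr1 pp pm two0; rewrite expr2 => e2 e1.
by apply: (mulfI (expf_neq0 m two0)); rewrite e1 e2.
Qed.

Lemma legendre3 (p : nat) : prime p -> p != 3 ->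
  legendre p%:Z 3 = if (p %% 3 == 1)%N then 1 else -1.
Proof.
move=> pp p3; have d3 : ~~ (3 %| p)%N by rewrite dvdn_prime2 // eq_sym.
rewrite /legendre dvdzE /= (negPf d3).
have -> // : [exists x : 'I_3, (x%:Z ^+ 2 == p%:Z %[mod 3%:Z])%Z] = (p %% 3 == 1)%N.
have xE (x : nat) : (x%:Z ^+ 2 == p%:Z %[mod 3%:Z])%Z = (x ^ 2 == p %[mod 3])%N.
  by rewrite -rmorphXn /= !modz_nat.
apply/existsP/idP => [[x] | /eqP p1].
  rewrite xE => /eqP xp; move: d3; rewrite /dvdn -xp.
  by case: x {xp} => -[|[|[|]]].
by exists (inord 1); rewrite xE inordK // p1.
Qed.

(** As m is even, 3 and -3 have the same character. A primitive cube root of unity w gives (2w+1)^2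
    = -3; conversely, a square root y of -3 makes (y-1)/2 an element of order 3, so 3 divides p -
    1. *)
Lemma euler3 (p h : nat) : prime p -> p = h.*2.*2.+1 ->
  3%:R ^+ h.*2 = (legendre p%:Z 3)%:~R :> 'F_p.
Proof.
set m := h.*2 => pp pm.
have p2 : (3 < p)%N.
  by have := prime_gt1 pp; rewrite pm /m; case: (h).
have two0 : 2%:R != 0 :> 'F_p by rewrite natr_Fp_eq0 // gtnNdvd // ltnW.
have three0 : 3%:R != 0 :> 'F_p by rewrite natr_Fp_eq0 // gtnNdvd.
have m3 : 3%:R ^+ m = (- 3%:R) ^+ m :> 'F_p.
  by rewrite [RHS]exprNn -signr_odd odd_double mul1r.
have cF : #|'F_p| = m.*2.+1 by rewrite card_Fp.
rewrite legendre3 //; last by rewrite gtn_eqF.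
have [/eqP p1 | p1] := boolP (p %% 3 == 1)%N.
  have [z] := finField_prim_root 'F_p; rewrite cF /= => pz.
  have d3 : (3 %| m.*2)%N.
    by have := divn_eq p 3; rewrite p1 addn1 {1}pm => -[->]; rewrite dvdn_mull.
  have := dvdn_prim_root pz d3; set w := z ^+ _ => pw.
  have w3 := prim_expr_order pw.
  have w1 : w - 1 != 0 by rewrite subr_eq0 -[w]expr1 -(prim_order_dvd pw).
  have ww : w ^+ 2 + w + 1 = 0.
    apply: (mulfI w1); rewrite mulr0; transitivity (w ^+ 3 - 1); first by ring.
    by rewrite w3 subrr.
  have sq : (2%:R * w + 1) ^+ 2 = - 3%:R.
    transitivity (4%:R * (w ^+ 2 + w + 1) - 3%:R); first by ring.
    by rewrite ww mulr0 sub0r.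
  rewrite m3 -sq exprAC (half_order_sqr1 pp pm) //.
  by apply: contraNneq three0 => y0; rewrite -oppr_eq0 -sq y0 expr0n.
have := half_order_sqr1 pp pm three0; move/eqP; rewrite sqrf_eq1.
case/orP=> /eqP E3; last by rewrite E3.
move/eqP: E3; rewrite m3 (expf_half_sqr cF) ?oppr_eq0 // => /existsP[y /eqP y3].
pose w := (y - 1) / 2%:R.
have ww : w ^+ 2 + w + 1 = 0.
  have w2 : 2%:R * w = y - 1 by rewrite /w mulrC divfK.
  apply: (mulfI (mulf_neq0 two0 two0)); rewrite mulr0.
  transitivity ((2%:R * w) ^+ 2 + 2%:R * (2%:R * w) + 4%:R); first by ring.
  by rewrite w2; transitivity (y ^+ 2 + 3%:R); [ring | rewrite y3 addNr].
have w3 : w ^+ 3 = 1.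
  by apply/eqP; rewrite -subr_eq0 -(mul0r (w - 1)) -ww; apply/eqP; ring.
have w1 : w != 1.
  apply: contraNneq three0 => w1; apply/eqP.
  by rewrite -ww w1; ring.
have [k pk k3] := @prim_order_exists _ 3 w isT w3.
have {}k3 : k = 3.
  move: (k3); rewrite dvdn_divisors // !inE => /orP[] /eqP kE //.
  by move: w1; rewrite -(prim_expr_order pk) kE expr1 eqxx.
have w0 : w != 0 by rewrite (prim_root_eq0 pk) k3.
have := expf_card_pred w0; rewrite cF /= => /eqP; rewrite -(prim_order_dvd pk) k3.
move=> d3; case/negP: p1.
by rewrite pm -addn1 -modnDml (eqP d3).
Qed.

(** * The character of the determinant *)

Lemma det_exprB_euler (p h k : nat) (a : 'I_k -> 'F_p) :
  prime p -> p = h.*2.*2.+1 -> k = h.*2 ->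
  (forall i, a i ^+ k = 1) -> injective a ->
  (\det (\matrix_(i, j) (a i - a j) ^+ k.+1)) ^+ h =
  3%:R ^+ k * h`!%:R ^+ k.
Proof.
move=> pp pm kE; subst k; set m := h.*2 => am ainj.
have h0 : (0 < h)%N by have := prime_gt1 pp; rewrite pm /m; case: (h).
have [n hn] : exists n, h = n.+1 by exists h.-1; rewrite prednK.
have mp : (m.+1 < p)%N by rewrite pm ltnS -addnn -addn1 leq_add2l double_gt0.
have cF : #|'F_p| = m.*2.+1 by rewrite card_Fp.
have [z pz] := finField_prim_root 'F_p.
have {pz} pz : m.-primitive_root (z ^+ 2).
  have := dvdn_prim_root pz; rewrite cF /= => /(_ m).
  by rewrite -(muln2 m) mulKn ?double_gt0 //; apply; rewrite dvdn_mulr.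
rewrite (det_exprB_roots h0 pz am ainj) -/m.
have -> : \prod_(i < m) red_coef 'F_p m i = (-1) ^+ h * m.+2%:R ^+ 2 *
   (\prod_(k < n.*2) 'C(m.+1, k.+2))%:R.
  by rewrite /m hn prod_red_coef.
set T : 'F_p := (\prod_(k < n.*2) _)%:R.
pose E (x : 'F_p) := x ^+ m.
have EM x y : E (x * y) = E x * E y by exact: exprMn.
(* The h-th power is only half of the character exponent m, so squares contribute the character of
   their root instead of vanishing. *)
have EE x : (x ^+ 2) ^+ h = E x by rewrite -exprM mul2n.
have E1 x : x != 0 -> E x * E x = 1.
  by move=> x0; rewrite -expr2; apply: (half_order_sqr1 pp pm).
have EN1 : E (-1) = 1 by rewrite /E -signr_odd odd_double.
have two0 : 2%:R != 0 :> 'F_p.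
  by rewrite natr_Fp_eq0 // gtnNdvd //; apply: leq_ltn_trans mp; rewrite /m hn doubleS.
set e := E 2%:R; have ee : e * e = 1 by apply: E1.
(* Doubling makes the characters computable: 2m = -1, 2(m+1) = 1 and 2(m+2) = 3 modulo p. *)
have eK x : E x = e * E (2%:R * x) by rewrite EM mulrA ee mul1r.
have p0 : m.*2.+1%:R = 0 :> 'F_p by apply/eqP; rewrite natr_Fp_eq0 // -pm.
have mm : 2%:R * m%:R = -1 :> 'F_p.
  by apply/eqP; rewrite -addr_eq0 -natrM natr1 mul2n p0.
have Em : E m%:R = e by rewrite eK mm EN1 mulr1.
have Em2 : E m.+2%:R = e * E 3%:R.
  have <- : 2%:R * m.+2%:R = 3%:R :> 'F_p.
    by rewrite -(addn2 m) natrD mulrDr mm; ring.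
  by rewrite EM mulrA ee mul1r.
have Em1 : E m.+1%:R = e.
  rewrite eK -[m.+1%:R]natr1 mulrDr mm mulr1.
  by have -> : -1 + 2%:R = 1 :> 'F_p by [ring]; rewrite /E expr1n mulr1.
have Ef : E (m`!)%:R = e by exact: fact_half_euler pp pm.
pose P := (\prod_(k < m) k`!)%N.
(* T ((m+1) P m!)^2 = ((m+1)!)^m, and m+1 and m! both have character e, so they cancel after raising
   to the power h. *)
have TP : T ^+ h * E P%:R = 1.
  have BF : ((\prod_(k < n.*2) 'C(m.+1, k.+2)) * (m.+1 * P * m`!) ^ 2 =
      m.+1`! ^ m)%N.
    by have := prod_bin_fact_inner n.*2; rewrite /P /m hn doubleS.
  have /(congr1 (fun x => x ^+ h)) : T * (m.+1%:R * P%:R * m`!%:R) ^+ 2 =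
      (m.+1%:R * m`!%:R) ^+ m.
    by rewrite /T -!natrM -!natrX -natrM BF.
  rewrite exprMn EE -/(E (m.+1%:R * m`!%:R)) !EM Em1 Ef ee expr1n => TE.
  by rewrite -[RHS]TE [e * _ * e]mulrAC ee mul1r.
(* The character of [prod_fact_double], in which the squared product disappears. *)
have Ph : E P%:R * (e ^+ h * E (h`!)%:R) = e.
  have := prod_fact_double h; rewrite -/m -/P.
  move/(congr1 (fun x : nat => E (x%:R : 'F_p))).
  rewrite !natrM !natrX !EM -/m Ef.
  have -> : E (2%:R ^+ h) = e ^+ h by rewrite /E exprAC.
  move=> ->; rewrite natr_prod E1 ?mul1r //.
  apply/prodf_neq0 => i _; rewrite fact_Fp_neq0 //.
  apply: leq_trans (ltnW mp); rewrite ltnS ltnW //.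
  by rewrite /m ltn_double.
have splitE A B C D :
    (- (A * (B * C ^+ 2 * D))) ^+ h = (-1) ^+ h * (A ^+ h * (B ^+ h * E C * D ^+ h)).
  by rewrite -EE -!exprMn mulN1r.
rewrite splitE Em2.
have -> : (m%:R ^+ m) ^+ h = e ^+ h by rewrite -Em.
have -> : ((-1) ^+ h) ^+ h = (-1) ^+ h :> 'F_p.
  by rewrite -exprM -signr_odd oddM andbb signr_odd.
have ehh : e ^+ h * e ^+ h = 1 by rewrite -exprMn ee expr1n.
have sh : (-1) ^+ h * (-1) ^+ h = 1 :> 'F_p.
  by rewrite -expr2 sqrr_sign.
rewrite -/(E 3%:R) -/(E h`!%:R).
transitivity (((-1) ^+ h * (-1) ^+ h) * e ^+ h * e * E 3%:R * T ^+ h); first by ring.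
rewrite sh mul1r -{2}Ph.
transitivity (e ^+ h * e ^+ h * (T ^+ h * E P%:R) * (E 3%:R * E h`!%:R)); first by ring.
by rewrite ehh TP !mul1r.
Qed.

(** * The nonresidue count below p/4, and the conclusion *)

Lemma prod_quarter_fact (p h : nat) : p = h.*2.*2.+1 ->
  (\prod_(r < p | (0 < r) && (4 * r < p)) r = h`!)%N.
Proof.
move=> pm; rewrite fact_prod.
rewrite (big_nat_widenl _ 0) // (@big_nat_widen _ _ _ _ _ p); last first.
  by rewrite pm ltnS -!addnn; lia.
rewrite big_mkord; apply: eq_bigl => r /=; congr (_ && _).
by move: (val r) => {}r; rewrite pm -!muln2; lia.
Qed.

Lemma legendre_sign (a : int) p : ~~ (p%:Z %| a)%Z ->
  legendre a p = if legendre a p == -1 then -1 else 1.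
Proof. by rewrite /legendre => /negPf->; case: ifP. Qed.

(** Each nonresidue contributes -1, so the sign is the product of the Legendre symbols of 1, ..., h,
    to which Euler's criterion applies factor by factor. *)
Lemma sign_card_quarter (p h : nat) : prime p -> p = h.*2.*2.+1 ->
  ((-1) ^+ #|[set r : 'I_p | [&& (0 < r)%N, (4 * r < p)%N
                              & legendre r%:Z p == -1]]|)%:~R =
  h`!%:R ^+ h.*2 :> 'F_p.
Proof.
move=> pp pm; have op : odd p by rewrite pm /= odd_double.
have kE : ((p - 1) %/ 2 = h.*2)%N by rewrite pm subn1 divn2 doubleK.
rewrite -prodr_const.
have -> : \prod_(r in [set r : 'I_p | [&& (0 < r)%N, (4 * r < p)%N
      & legendre r%:Z p == -1]]) (-1 : int) =
    \prod_(r < p | (0 < r)%N && (4 * r < p)%N) legendre r%:Z p.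
  rewrite (eq_bigl (fun r : 'I_p => ((0 < r)%N && (4 * r < p)%N) &&
     (legendre r%:Z p == -1))); last by move=> r; rewrite inE andbA.
  rewrite big_mkcondr; apply: eq_bigr => r /andP[r0 _].
  by rewrite -legendre_sign // dvdzE /= gtnNdvd.
rewrite -(prod_quarter_fact pm) rmorph_prod natr_prod -prodrXl.
by apply: eq_bigr => r _; rewrite /= euler_legendre // kE.
Qed.

Theorem corollary1p10 (p : nat) (alpha : 'I_((p - 1) %/ 2) -> int)
    (p_prime : prime p) (p_mod4 : (p = 1 %[mod 4])%N)
    (alphaP : represents_residues alpha) :
  let S := S2 (1 + (p - 1) %/ 2)%N (-1) alpha in
  (exists s : int, 0 <= s /\ s ^+ 2 = S) /\
  (forall s : int, s ^+ 2 = S ->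
     legendre s p =
       (-1) ^+ #|[set r : 'I_p | [&& (0 < r)%N, (4 * r < p)%N
                                  & legendre r%:Z p == -1]]|
       * legendre p%:Z 3).
Proof.
have [h ph] : exists h, p = h.*2.*2.+1.
  by exists (p %/ 4)%N; have := divn_eq p 4; rewrite p_mod4 -!muln2; lia.
have kE : ((p - 1) %/ 2 = h.*2)%N by rewrite ph subn1 divn2 doubleK.
have op : odd p by rewrite ph /= odd_double.
case: alphaP => alpha1 alpha_inj _ S; split.
  (* The matrix is skew because the exponent 2h+1 is odd. *)
  apply: det_skew_int; apply/matrixP=> i j; rewrite !mxE !mulN1r.
  by rewrite -opprB exprNn add1n -signr_odd /= kE odd_double mulN1r.
move=> s sS; apply: (intr_Fp_sign_inj p_prime op).
- exact: legendre_mem.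
- rewrite -signr_odd legendre3 //; last by apply: contra_eq_neq p_mod4 => ->.
  by case: odd; case: ifP.
rewrite rmorphM /= (sign_card_quarter p_prime ph) -(euler3 p_prime ph).
(* Since s^(2h) = (s^2)^h = S^h, the sign of s is irrelevant. *)
rewrite euler_legendre // kE -[h.*2 in LHS]mul2n exprM -rmorphXn sS [RHS]mulrC.
rewrite -det_map_mx -kE.
pose a i : 'F_p := (alpha i)%:~R.
rewrite -(@det_exprB_euler _ _ _ a p_prime ph kE).
- congr (\det _ ^+ _); apply/matrixP=> i j.
  by rewrite !mxE rmorphXn /= mulN1r rmorphB.
- by move=> i; rewrite /a -euler_legendre // alpha1.
- move=> i j /eqP; rewrite intr_Fp_eq // => /eqP; exact: alpha_inj.
Qed.
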